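(* Let $n\ge 3$ and let $(x,X)\in \mathrm{QPB}_n$. Then for all pairwise distinct indices $i,j,k\in\{1,\ldots,n\}$ the inequalities $$\text{(ETRI1)}\quad 2x_i + X_{ii} - 2X_{ij} - 2X_{ik} + X_{jk} \ge 0,$$ $$\text{(ETRI2)}\quad 4x_i + 4X_{ii} - 4X_{ij} - 4X_{ik} + X_{jk} \ge 0,$$ $$\text{(ETRI3)}\quad 4x_i + 4X_{ii} - 8X_{ij} - 4X_{ik} + X_{jj} + 3X_{jk} \ge 0,$$ hold, and so do all inequalities obtained from these by switching the variables in an arbitrary subset $S\subseteq\{i,j,k\}$.
   Context: Let $\mathrm{Box}_n=\{x\in\mathbb{R}^n : 0\le x_i\le 1,\ i=1,\ldots,n\}$. For $x\in\mathbb{R}^n$ and a symmetric $n\times n$ matrix $X$ let $Y(x,X)=\begin{pmatrix}1 & x^T\\ x & X\end{pmatrix}$. Let $\mathrm{QPB}_n$ be the convex hull of $\{(1,x^T)^T(1,x^T) : x\in\mathrm{Box}_n\}$, a set of symmetric $(n+1)\times(n+1)$ matrices; $(x,X)\in\mathrm{QPB}_n$ means $Y(x,X)\in\mathrm{QPB}_n$. Switching the variables in a set $S$ of indices in an inequality in $(x,X)$ means making simultaneously the following substitutions: $x_p\mapsto 1-x_p$ for $p\in S$ and $x_p\mapsto x_p$ for $p\notin S$; $X_{pp}\mapsto 1-2x_p+X_{pp}$ for $p\in S$ and $X_{pp}\mapsto X_{pp}$ for $p\notin S$; and for $p\ne q$: $X_{pq}\mapsto X_{pq}$ if $p,q\notin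 S$, $X_{pq}\mapsto x_q-X_{pq}$ if $p\in S$, $q\notin S$, and $X_{pq}\mapsto X_{pq}+1-x_p-x_q$ if $p,q\in S$. *)

(* Defs.v *)
From HB Require Import structures.
From mathcomp Require Import all_boot all_order all_algebra.
From mathcomp Require Import classical_sets reals convex.

Set Implicit Arguments.
Unset Strict Implicit.
Unset Printing Implicit Defensive.

Import Order.TTheory GRing.Theory Num.Theory.

Local Open Scope classical_set_scope.
Local Open Scope ring_scope.

Definition Box (R : realType) (n : nat) : set 'cV[R]_n :=
  [set x | forall i, 0 <= x i 0 <= 1].

Arguments Box : clear implicits.

Definition convex_hull (R : realType) (V : lmodType R) (A : set V) : set V :=
  smallest (@convex_set R V) A.

Definition Ymx (R : realType) (n : nat) (x : 'cV[R]_n) (X : 'M[R]_n) :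
    'M[R]_(1 + n) :=
  block_mx 1%:M x^T x X.

Definition QPB (R : realType) (n : nat) : set 'M[R]_(1 + n) :=
  convex_hull
    [set (row_mx 1%:M x^T)^T *m row_mx 1%:M x^T | x in Box R n].

Arguments QPB : clear implicits.

(* An inequality in [(x, X)], given by the set of pairs that satisfy it. *)
Definition ineq (R : realType) (n : nat) : Type := 'cV[R]_n -> 'M[R]_n -> Prop.

Definition ETRI1 (R : realType) (n : nat) (i j k : 'I_n) : ineq R n :=
  fun x X => 2 * x i 0 + X i i - 2 * X i j - 2 * X i k + X j k >= 0.

Definition ETRI2 (R : realType) (n : nat) (i j k : 'I_n) : ineq R n :=
  fun x X => 4 * x i 0 + 4 * X i i - 4 * X i j - 4 * X i k + X j k >= 0.

Definition ETRI3 (R : realType) (n : nat) (i j k : 'I_n) : ineq R n :=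
  fun x X =>
    4 * x i 0 + 4 * X i i - 8 * X i j - 4 * X i k + X j j + 3 * X j k >= 0.

Definition switch_vec (R : realType) (n : nat) (S : {set 'I_n})
    (x : 'cV[R]_n) : 'cV[R]_n :=
  \col_p (if p \in S then 1 - x p 0 else x p 0).

(* The case [p \notin S], [q \in S] is the one for [p \in S], [q \notin S]
   transposed, as [X] is symmetric. *)
Definition switch_mx (R : realType) (n : nat) (S : {set 'I_n})
    (x : 'cV[R]_n) (X : 'M[R]_n) : 'M[R]_n :=
  \matrix_(p, q)
    if p == q then
      if p \in S then 1 - 2 * x p 0 + X p p else X p p
    else
      match p \in S, q \in S with
      | false, false => X p q
      | true, false => x q 0 - X p q
      | false, true => x p 0 - X p q
      | true, true => X p q + 1 - x p 0 - x q 0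
      end.

(* Evaluating an inequality at the switched pair is the same as performing the
   substitutions simultaneously in its expression. *)
Definition switch (R : realType) (n : nat) (S : {set 'I_n}) (I : ineq R n) :
    ineq R n :=
  fun x X => I (switch_vec S x) (switch_mx S x X).

(* Main.v *)
Require Import Defs.
From HB Require Import structures.
From mathcomp Require Import all_boot all_order all_algebra.
From mathcomp Require Import classical_sets reals.
From mathcomp Require Import interval_inference convex.
From mathcomp Require Import ring lra.

Import Order.TTheory GRing.Theory Num.Theory.

Local Open Scope ring_scope.

(** Each inequality is affine in [(x, X)], so it is valid on the convex hull
    [QPB] as soon as it is valid at the generators, where [x = y] is a point of
    the box and [X = y *m y^T] ([QPB_ind]). There it becomes the nonnegativity
    of a polynomial in three numbers [a], [b], [c] of the unit interval (the
    coordinates [i], [j], [k] of [y]), for which [ETRI1_box], [ETRI2_box] and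
    [ETRI3_box] give certificates: sums of products of squares and of the
    factors [a], [b], [c], [1 - b], [1 - c].

    The switched inequalities then come for free: switching is the affine map
    that extends the reflections of the box, so it maps [QPB] to itself
    ([QPB_switch]), and an inequality valid on [QPB] remains valid after
    switching. *)

Lemma Ymx_rank1 (R : realType) (n : nat) (y : 'cV[R]_n) :
  (row_mx 1%:M y^T)^T *m row_mx 1%:M y^T = Ymx y (y *m y^T).
Proof.
by rewrite tr_row_mx trmxK trmx1 mul_col_row !mul1mx mulmx1.
Qed.

(** The condition [a + b = 1] serves the constant corner entry [1]. *)
Lemma Ymx_conv (R : realType) (n : nat) (a b : R) (x y : 'cV[R]_n)
    (X Y : 'M[R]_n) :
  a + b = 1 ->
  Ymx (a *: x + b *: y) (a *: X + b *: Y) = a *: Ymx x X + b *: Ymx y Y.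
Proof.
move=> ab1; rewrite /Ymx !scale_block_mx add_block_mx.
by rewrite -scalerDl ab1 scale1r linearD !linearZ.
Qed.

Lemma QPB_rank1 (R : realType) (n : nat) (y : 'cV[R]_n) :
  Box R n y -> QPB R n (Ymx y (y *m y^T)).
Proof.
by move=> yB; apply: sub_gen_smallest; exists y; rewrite // Ymx_rank1.
Qed.

Lemma QPB_conv (R : realType) (n : nat) (a b : R) (M N : 'M[R]_(1 + n)) :
  0 <= a -> 0 <= b -> a + b = 1 -> QPB R n M -> QPB R n N ->
  QPB R n (a *: M + b *: N).
Proof.
move=> a0 b0 ab1 hM hN A [convA genA].
have a1 : a <= 1 by rewrite -ab1 lerDl.
have -> : b = 1 - a by rewrite -ab1 addrC addKr.
have := convA M N (Itv01 a0 a1); rewrite !inE; apply.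
  exact: hM.
exact: hN.
Qed.

(** The matrices whose lower blocks satisfy [P] form a convex set containing
    the generators, hence containing their hull. *)
Lemma QPB_ind (R : realType) (n : nat) (P : 'cV[R]_n -> 'M[R]_n -> Prop) :
  (forall y, Box R n y -> P y (y *m y^T)) ->
  (forall a b x y X Y, 0 <= a -> 0 <= b -> a + b = 1 -> P x X -> P y Y ->
     P (a *: x + b *: y) (a *: X + b *: Y)) ->
  forall x X, QPB R n (Ymx x X) -> P x X.
Proof.
move=> Prank1 Pconv x X hxX.
pose A := [set M : 'M[R]_(1 + n) | P (dlsubmx M) (drsubmx M)]%classic.
suff : A (Ymx x X) by rewrite /A /= /Ymx block_mxKdl block_mxKdr.
have convA a b (M N : 'M[R]_(1 + n)) : 0 <= a -> 0 <= b -> a + b = 1 ->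
    A M -> A N -> A (a *: M + b *: N).
  move=> a0 b0 ab1 AM AN; have := Pconv _ _ _ _ _ _ a0 b0 ab1 AM AN.
  by congr P; apply/matrixP => p q; rewrite !mxE.
move: (Ymx x X) hxX; apply: smallest_sub => [M N t|_ [y yB <-]].
  rewrite !inE; apply: convA => //; first by rewrite subr_ge0.
  by rewrite addrC subrK.
by rewrite Ymx_rank1 /A /= /Ymx block_mxKdl block_mxKdr; apply: Prank1.
Qed.

Lemma Box_switch (R : realType) (n : nat) (S : {set 'I_n}) (y : 'cV[R]_n) :
  Box R n y -> Box R n (switch_vec S y).
Proof.
move=> yB i; rewrite mxE; case: ifP => _; last exact: yB.
by have /andP[y0 y1] := yB i; rewrite subr_ge0 y1 gerBl.
Qed.

Lemma switch_mx_rank1 (R : realType) (n : nat) (S : {set 'I_n})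
    (y : 'cV[R]_n) :
  switch_mx S y (y *m y^T) = switch_vec S y *m (switch_vec S y)^T.
Proof.
apply/matrixP => p q; rewrite !mxE !big_ord1 !mxE.
case: eqP => [->|_]; first by case: (q \in S) => //; ring.
by case: (p \in S); case: (q \in S) => //; ring.
Qed.

(** Affine rather than linear combinations: the constant terms of the
    substitutions are preserved because [a + b = 1]. *)
Lemma switch_vec_conv (R : realType) (n : nat) (S : {set 'I_n}) (a b : R)
    (x y : 'cV[R]_n) :
  a + b = 1 ->
  switch_vec S (a *: x + b *: y) = a *: switch_vec S x + b *: switch_vec S y.
Proof.
move=> ab1; have -> : b = 1 - a by rewrite -ab1 addrC addKr.
apply/matrixP => p q; rewrite !mxE; case: (p \in S) => //; ring.
Qed.

Lemma switch_mx_conv (R : realType) (n : nat) (S : {set 'I_n}) (a b : R)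
    (x y : 'cV[R]_n) (X Y : 'M[R]_n) :
  a + b = 1 ->
  switch_mx S (a *: x + b *: y) (a *: X + b *: Y) =
  a *: switch_mx S x X + b *: switch_mx S y Y.
Proof.
move=> ab1; have -> : b = 1 - a by rewrite -ab1 addrC addKr.
apply/matrixP => p q; rewrite !mxE.
case: eqP => [->|_]; first by case: (q \in S) => //; ring.
by case: (p \in S); case: (q \in S) => //; ring.
Qed.

(** The rank-one generators of [QPB] are permuted by the reflections
    [y_p |-> 1 - y_p] of the box, and switching extends this action to an
    affine map of the pairs [(x, X)], so it preserves the convex hull. *)
Lemma QPB_switch (R : realType) (n : nat) (S : {set 'I_n}) (x : 'cV[R]_n)
    (X : 'M[R]_n) :
  QPB R n (Ymx x X) -> QPB R n (Ymx (switch_vec S x) (switch_mx S x X)).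
Proof.
move: x X; apply: QPB_ind => [y yB|a b x y X Y a0 b0 ab1 hx hy].
  by rewrite switch_mx_rank1; apply: QPB_rank1; apply: Box_switch.
by rewrite switch_vec_conv // switch_mx_conv // Ymx_conv //; apply: QPB_conv.
Qed.

(** The expression is affine in [b] and in [c], hence equal to the bilinear
    interpolation of its values at the vertices of the square of all [(b, c)];
    these values are [2 * a + a ^+ 2], [a ^+ 2] (twice) and [(1 - a) ^+ 2]. *)
Lemma ETRI1_box (R : realFieldType) (a b c : R) :
  0 <= a <= 1 -> 0 <= b <= 1 -> 0 <= c <= 1 ->
  0 <= 2 * a + a * a - 2 * (a * b) - 2 * (a * c) + b * c.
Proof.
move=> /andP[a0 a1] /andP[b0 b1] /andP[c0 c1].
have -> : 2 * a + a * a - 2 * (a * b) - 2 * (a * c) + b * c =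
  (1 - b) * (1 - c) * (2 * a + a ^+ 2) + b * (1 - c) * a ^+ 2 +
  (1 - b) * c * a ^+ 2 + b * c * (1 - a) ^+ 2 by ring.
by do !first [done | exact: sqr_ge0 | rewrite subr_ge0 | apply: mulr_ge0
  | apply: addr_ge0].
Qed.

(** Bilinear interpolation in [(b, c)] again, the vertex values being
    [4 * a + 4 * a ^+ 2], [4 * a ^+ 2] (twice) and [(2 * a - 1) ^+ 2]. *)
Lemma ETRI2_box (R : realFieldType) (a b c : R) :
  0 <= a <= 1 -> 0 <= b <= 1 -> 0 <= c <= 1 ->
  0 <= 4 * a + 4 * (a * a) - 4 * (a * b) - 4 * (a * c) + b * c.
Proof.
move=> /andP[a0 a1] /andP[b0 b1] /andP[c0 c1].
have -> : 4 * a + 4 * (a * a) - 4 * (a * b) - 4 * (a * c) + b * c =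
  (1 - b) * (1 - c) * (4 * a + 4 * a ^+ 2) + b * (1 - c) * (4 * a ^+ 2) +
  (1 - b) * c * (4 * a ^+ 2) + b * c * (2 * a - 1) ^+ 2 by ring.
by do !first [done | exact: sqr_ge0 | rewrite subr_ge0 | apply: mulr_ge0
  | apply: addr_ge0].
Qed.

(** Here the expression is affine in [c] only; it interpolates between
    [4 * a * (1 - b) + (2 * a - b) ^+ 2] at [c = 0] and
    [4 * (a - b) ^+ 2 + 3 * b * (1 - b)] at [c = 1]. *)
Lemma ETRI3_box (R : realFieldType) (a b c : R) :
  0 <= a <= 1 -> 0 <= b <= 1 -> 0 <= c <= 1 ->
  0 <= 4 * a + 4 * (a * a) - 8 * (a * b) - 4 * (a * c) + b * b + 3 * (b * c).
Proof.
move=> /andP[a0 a1] /andP[b0 b1] /andP[c0 c1].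
have -> : 4 * a + 4 * (a * a) - 8 * (a * b) - 4 * (a * c) + b * b
    + 3 * (b * c) =
  (1 - c) * (4 * a * (1 - b) + (2 * a - b) ^+ 2) +
  c * (4 * (a - b) ^+ 2 + 3 * b * (1 - b)) by ring.
by do !first [done | exact: sqr_ge0 | rewrite subr_ge0 | apply: mulr_ge0
  | apply: addr_ge0].
Qed.

Lemma QPB_ETRI (R : realType) (n : nat) (i j k : 'I_n) (x : 'cV[R]_n)
    (X : 'M[R]_n) :
  QPB R n (Ymx x X) -> [/\ ETRI1 i j k x X, ETRI2 i j k x X & ETRI3 i j k x X].
Proof.
move: x X; apply: QPB_ind => [y yB|a b x y X Y a0 b0 _ [x1 x2 x3] [y1 y2 y3]].
  rewrite /ETRI1 /ETRI2 /ETRI3 !mxE !big_ord1 !mxE.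
  by split; [exact: ETRI1_box|exact: ETRI2_box|exact: ETRI3_box].
(* each left-hand side is linear in the pair, so its value at the convex
   combination is the same combination of its values at the two points *)
move: (addr_ge0 (mulr_ge0 a0 x1) (mulr_ge0 b0 y1))
  (addr_ge0 (mulr_ge0 a0 x2) (mulr_ge0 b0 y2))
  (addr_ge0 (mulr_ge0 a0 x3) (mulr_ge0 b0 y3)).
by rewrite /ETRI1 /ETRI2 /ETRI3 !mxE => h1 h2 h3; split; lra.
Qed.

Theorem mainTheorem1 (R : realType) (n : nat) (hn : (3 <= n)%N)
    (x : 'cV[R]_n) (X : 'M[R]_n) (hX : X^T = X)
    (hxX : QPB R n (Ymx x X))
    (i j k : 'I_n) (hij : i != j) (hik : i != k) (hjk : j != k) :
  [/\ ETRI1 i j k x X, ETRI2 i j k x X & ETRI3 i j k x X] /\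
  (forall S : {set 'I_n}, S \subset [set i; j; k]%SET ->
    [/\ switch S (ETRI1 i j k) x X, switch S (ETRI2 i j k) x X
      & switch S (ETRI3 i j k) x X]).
Proof.
split=> [|S _]; first exact: QPB_ETRI.
by apply: QPB_ETRI; apply: QPB_switch.
Qed.
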